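(* Let $G$ be a connected graph on $n$ vertices, and let $D$ be its distance matrix, with eigenvalues $\tilde\lambda_1\ge\cdots\ge\tilde\lambda_n$ (with multiplicity). Then $$\mathrm{eq}(G)\le\bigl|\{i:\tilde\lambda_i\le-1\}\bigr|+1.$$
   Context: Graphs are finite, simple and undirected; $d(u,v)$ is the shortest-path distance, and the distance matrix $D$ has entries $D_{uv}=d(u,v)$. A set $S\subseteq V(G)$ is $t$-equidistant if $d(u,v)=t$ for all distinct $u,v\in S$; $\mathrm{eq}_t(G)$ is the maximum size of a $t$-equidistant set; and the equidistant number is $\mathrm{eq}(G)=\max\{\mathrm{eq}_t(G):1\le t\le\mathrm{diam}(G)\}$. *)

(* Defs.v *)
From mathcomp Require Import all_boot all_order all_algebra.

Set Implicit Arguments.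
Unset Strict Implicit.
Unset Printing Implicit Defensive.

Import Order.TTheory GRing.Theory Num.Theory.

(* A finite simple graph is a symmetric irreflexive relation e on a finType. *)

Definition connected_graph (T : finType) (e : rel T) : Prop :=
  (0 < #|T|)%N /\ forall u v : T, connect e u v.

(* u :: p is the vertex sequence, so a path with k edges has p of size k. *)
Definition has_path_of_length (T : finType) (e : rel T) (k : nat) (u v : T)
  : bool :=
  [exists p : k.-tuple T,
     [&& path e u p, uniq (u :: p) & last u p == v]].

(* A path has fewer than #|T| edges, so the minimum ranges over all path
   lengths; the default #|T| is only reached when no path joins u to v. *)
Definition gdist (T : finType) (e : rel T) (u v : T) : nat :=
  \big[minn/#|T|]_(k < #|T| | has_path_of_length e k u v) (k : nat).

Definition diam (T : finType) (e : rel T) : nat :=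
  \max_(u : T) \max_(v : T) gdist e u v.

Definition equidistant (T : finType) (e : rel T) (t : nat) (S : {set T})
  : bool :=
  [forall u in S, forall v in S, (u != v) ==> (gdist e u v == t)].

Definition eq_t (T : finType) (e : rel T) (t : nat) : nat :=
  \max_(S : {set T} | equidistant e t S) #|S|.

(* On a one-vertex graph the range of t is empty and the maximum is 0. *)
Definition equidistant_number (T : finType) (e : rel T) : nat :=
  \max_(1 <= t < (diam e).+1) eq_t e t.

Definition distance_matrix (R : rcfType) (T : finType) (e : rel T)
  : 'M[R]_#|T| :=
  \matrix_(i < #|T|, j < #|T|) ((gdist e (enum_val i) (enum_val j))%:R)%R.

(* lam lists the eigenvalues of A with multiplicity, in non-increasing order:
   they are the roots of the characteristic polynomial, which splits over R
   when A is symmetric. *)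
Definition is_spectrum (R : rcfType) (n : nat) (A : 'M[R]_n)
    (lam : n.-tuple R) : Prop :=
  (char_poly A = \prod_(i < n) ('X - (tnth lam i)%:P))%R /\
  (forall i j : 'I_n, (i <= j)%N -> (tnth lam j <= tnth lam i)%R).

(* Main.v *)
Require Import Defs.
From mathcomp Require Import all_boot all_order all_algebra complex.

Set Implicit Arguments.
Unset Strict Implicit.
Unset Printing Implicit Defensive.

Import Order.TTheory GRing.Theory Num.Theory.

(** Vectors supported on a t-equidistant set S whose entries sum to 0 form a
    space of dimension #|S| - 1, and there the quadratic form of D equals
    -t |x|^2 <= -|x|^2, because the principal submatrix of D on S is t (J - I).
    The eigenvectors for eigenvalues > -1 span a space where the form exceeds
    -|x|^2 (for x <> 0), so the two spaces meet trivially and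
    #|S| - 1 <= #{i | lam_i <= -1}. The spectral theorem is applied over R[i]. *)

Lemma has_path_of_length_rev (T : finType) (e : rel T) (e_sym : symmetric e) k u v :
  has_path_of_length e k u v -> has_path_of_length e k v u.
Proof.
case/existsP=> p /and3P[pth un /eqP lst].
(* Since [p] omits its start [u], the reversed path without its start [v] is [rev (belast u p)]. *)
have sz : size (rev (belast u p)) == k by rewrite size_rev size_belast size_tuple.
apply/existsP; exists (Tuple sz) => /=.
have E : v :: rev (belast u p) = rev (u :: p).
  by rewrite [u :: _]lastI rev_rcons lst.
apply/and3P; split.
- rewrite -lst rev_path; apply: sub_path pth => x y /=.
  by rewrite e_sym.
- by move: un; rewrite -rev_uniq -E.
- have : last u (v :: rev (belast u p)) = u by rewrite E rev_cons last_rcons.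
  by move=> /= ->.
Qed.

Lemma gdist_sym (T : finType) (e : rel T) (e_sym : symmetric e) u v :
  gdist e u v = gdist e v u.
Proof.
by apply: eq_bigl => k; apply/idP/idP; apply: has_path_of_length_rev.
Qed.

Lemma gdistxx (T : finType) (e : rel T) u : gdist e u u = 0%N.
Proof.
have T0 : (0 < #|T|)%N by apply/card_gt0P; exists u.
(* Once [#|T|] is a successor, [k = 0] is the first index of the minimum, and the empty path
   realises it. *)
rewrite /gdist; case: #|T| T0 => // m _.
rewrite /index_enum -enumT enum_ordSl big_cons ifT ?min0n //.
by apply/existsP; exists [tuple] => /=; rewrite eqxx.
Qed.

Local Open Scope ring_scope.
Local Open Scope sesquilinear_scope.

(** Otherwise fewer than [n] linear conditions would leave a nonzero [x] in the kernel of [M] and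
    orthogonal to all eigenvectors for eigenvalues at most [c], where the form exceeds [c] times the
    squared norm. Giving the subspace as a kernel bounds its codimension by the column count [k]. *)
Lemma leq_dim_add_count_eigenvalues (C : numClosedFieldType) (n k : nat)
    (A : 'M[C]_n) (mu : seq C) (M : 'M[C]_(n, k)) (c : C) :
    c \is Num.real -> A \is hermsymmx ->
    char_poly A = \prod_(x <- mu) ('X - x%:P) ->
    (forall x : 'rV_n, x *m M = 0 ->
      (x *m A *m x^t*) 0 0 <= c * (x *m x^t*) 0 0) ->
  (n <= k + count (fun x => (x <= c)%R) mu)%N.
Proof.
move=> c_real Aherm Amu leA.
set P := spectralmx A; set d := spectral_diag A.
have A_eq : A = invmx P *m diag_mx d *m P.
  exact/orthomx_spectralP/hermitian_normalmx.
have Pu : P \is unitarymx := spectral_unitarymx A.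
have PU : P \in unitmx := spectral_unit A.
have d_real i : d 0 i \is Num.real.
  by have /mxOverP := hermitian_spectral_diag_real Aherm.
(* Conjugation by [P] preserves the characteristic polynomial, and its factorisation into linear
   factors is unique up to order. *)
have d_mu : perm_eq mu [seq d 0 i | i <- enum 'I_n].
  apply: prod_XsubC_eq; rewrite -Amu big_map big_enum /=.
  transitivity (char_poly (diag_mx d)).
    rewrite /char_poly /char_poly_mx A_eq.
    set Q := map_mx polyC P.
    have QU : Q \in unitmx by rewrite map_unitmx.
    have -> : 'X%:M - map_mx polyC (invmx P *m diag_mx d *m P) =
       invmx Q *m ('X%:M - map_mx polyC (diag_mx d)) *m Q.
      rewrite mulmxBr mulmxBl !map_mxM map_invmx.
      by rewrite scalar_mxC mulmxKV.
    by rewrite !det_mulmx mulrAC -det_mulmx mulVmx // det1 mul1r.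
  rewrite char_poly_trig ?diag_mx_is_trig //.
  by apply: eq_bigr => i _; rewrite mxE eqxx.
rewrite (permP d_mu) count_map.
pose J := [set i | d 0 i <= c].
have -> : count (preim (d 0) (fun x : C => x <= c)) (enum 'I_n) = #|J|.
  by rewrite -sum1_count -sum1_card big_enum_cond; apply: eq_bigl => i; rewrite [RHS]inE.
rewrite leqNgt; apply/negP => lt_n.
(* N adds the constraints of orthogonality to the eigenvectors for d 0 i <= c. *)
pose N : 'M[C]_(n, k + #|J|) := row_mx M (\matrix_(i, j) (P^t*) i (enum_val j)).
have : kermx N != 0.
  rewrite kermx_eq0 -row_leq_rank -ltnNge.
  exact: leq_ltn_trans (rank_leq_col _) lt_n.
case/rowV0Pn => x /sub_kermxP; rewrite mul_mx_row -[0]hsubmxK => /eq_row_mx[].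
rewrite !linear0 => xM xJ x0.
(* [y] holds the coordinates of [x] in the orthonormal eigenbasis formed by the rows of [P]. *)
pose y := x *m P^t*.
have yJ i : d 0 i <= c -> y 0 i = 0.
  move=> iJ; have iJ' : i \in J by rewrite inE.
  have /rowP/(_ (enum_rank_in iJ' i)) := xJ.
  rewrite [RHS]mxE => <-; rewrite !mxE; apply: eq_bigr => j _.
  by rewrite [in RHS]mxE enum_rankK_in.
have xy : x = y *m P.
  by rewrite /y -invmx_unitary // mulmxKV.
have normE (z : C) : z * z^* = `|z| ^+ 2 by rewrite normCK.
have yy : (x *m x^t*) 0 0 = \sum_i `|y 0 i| ^+ 2.
  rewrite {2}xy trmx_mul map_mxM mulmxA -/y mxE.
  by apply: eq_bigr => i _; rewrite !mxE normE.
have yAy : (x *m A *m x^t*) 0 0 = \sum_i d 0 i * `|y 0 i| ^+ 2.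
  rewrite A_eq !mulmxA invmx_unitary // -/y.
  rewrite {1}xy trmx_mul map_mxM mulmxA -(mulmxA _ P) (unitarymxP Pu) mulmx1.
  by rewrite mxE; apply: eq_bigr => i _; rewrite mul_mx_diag !mxE mulrAC normE mulrC.
have := leA x xM; rewrite yy yAy mulr_sumr -subr_le0 -sumrB.
(* Either [d 0 i <= c] and [y 0 i = 0], or the factor [d 0 i - c] is positive. The order on [C] is
   only partial, so this dichotomy rests on both numbers being real. *)
have ge0 i : 0 <= d 0 i * `|y 0 i| ^+ 2 - c * `|y 0 i| ^+ 2.
  rewrite -mulrBl; case: (real_leP (d_real i) c_real) => [/yJ ->|lt_c].
    by rewrite normr0 expr0n mulr0.
  by rewrite mulr_ge0 ?exprn_ge0 // subr_ge0 ltW.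
move=> sum_le0.
have /psumr_eq0P z : \sum_i (d 0 i * `|y 0 i| ^+ 2 - c * `|y 0 i| ^+ 2) = 0.
  by apply/eqP; rewrite eq_le sum_le0 sumr_ge0.
case/eqP: x0; rewrite xy; suff -> : y = 0 by rewrite mul0mx.
apply/rowP => i; rewrite [RHS]mxE.
case: (real_leP (d_real i) c_real) => [/yJ //|lt_c].
have /eqP := z (fun i _ => ge0 i) i isT.
by rewrite -mulrBl mulf_eq0 subr_eq0 (gt_eqF lt_c) expf_eq0 normr_eq0 => /eqP.
Qed.

(** The previous bound with [c = -1]; the summand 1 pays for the condition that the entries of [x]
    sum to 0. *)
Lemma leq_card_equidistant_count (C : numClosedFieldType) (n : nat)
    (A : 'M[C]_n) (mu : seq C) (S : {set 'I_n}) (t : C) :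
    A \is hermsymmx -> char_poly A = \prod_(x <- mu) ('X - x%:P) -> 1 <= t ->
    {in S &, forall i j, A i j = t *+ (i != j)} ->
  (#|S| <= count (fun x => (x <= -1)%R) mu + 1)%N.
Proof.
move=> Aherm Amu t1 AS.
(* The first block kills the entries outside [S], the last column their sum. *)
pose M : 'M[C]_(n, #|~: S| + 1) :=
  row_mx (\matrix_(i, j) (i == enum_val j)%:R) (const_mx 1).
suff : (n <= (#|~: S| + 1) + count (fun x => (x <= -1)%R) mu)%N.
  rewrite -{1}(card_ord n) -(cardsC S) addnC -addnA leq_add2l.
  by rewrite addnC.
have Nreal : -1 \is @Num.real C by rewrite realN real1.
apply: (leq_dim_add_count_eigenvalues (M := M) Nreal Aherm Amu) => x.
rewrite mul_mx_row -[0]hsubmxK => /eq_row_mx[]; rewrite !linear0 => xS xsum.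
have x_out i : i \notin S -> x 0 i = 0.
  rewrite -in_setC => iS.
  have /rowP/(_ (enum_rank_in iS i)) := xS.
  rewrite [RHS]mxE => <-; rewrite mxE (bigD1 i) //= big1 => [|j ji].
    by rewrite mxE enum_rankK_in // eqxx mulr1 addr0.
  by rewrite mxE enum_rankK_in // (negPf ji) mulr0.
have sum0 : \sum_i x 0 i = 0.
  have /rowP/(_ 0) := xsum; rewrite [RHS]mxE => {2}<-; rewrite mxE.
  by apply: eq_bigr => i _; rewrite mxE mulr1.
have xx : (x *m x^t*) 0 0 = \sum_i `|x 0 i| ^+ 2.
  by rewrite mxE; apply: eq_bigr => i _; rewrite !mxE normCK.
have xA i : i \in S -> (x *m A) 0 i = - t * x 0 i.
  move=> iS; rewrite mxE.
  (* Row [i] of [t (J - I)] may replace that of [A]: the two can differ only at columns outside [S],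
     where [x] vanishes. *)
  transitivity (\sum_j (t * x 0 j - (t * x 0 i) *+ (j == i))).
    apply: eq_bigr => j _; have [jS|/x_out xj] := boolP (j \in S).
      by rewrite AS //; case: eqVneq => [->|_]; rewrite ?mulr0 ?subrr ?subr0 // mulrC.
    rewrite xj mul0r mulr0; case: eqVneq xj => [-> ->|]; last by rewrite subr0.
    by rewrite mulr0 subr0.
  rewrite sumrB -mulr_sumr sum0 mulr0 sub0r (bigD1 i) //= eqxx big1 ?addr0 ?mulNr //.
  by move=> j /negPf ->.
have -> : (x *m A *m x^t*) 0 0 = - t * (x *m x^t*) 0 0.
  rewrite xx mulr_sumr mxE; apply: eq_bigr => i _; rewrite [x^t* _ _]mxE [x^T _ _]mxE.
  rewrite normCK; have [/xA ->|/x_out ->] := boolP (i \in S).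
    by rewrite mulrA.
  by rewrite conjC0 !mulr0.
rewrite ler_wpM2r ?lerN2 // xx sumr_ge0 // => i _.
by rewrite exprn_ge0.
Qed.

Local Close Scope sesquilinear_scope.
Local Close Scope ring_scope.

Theorem corollary26 (R : rcfType) (T : finType) (e : rel T)
    (e_sym : symmetric e) (e_irr : irreflexive e)
    (e_conn : connected_graph e)
    (lam : #|T|.-tuple R)
    (lam_spec : is_spectrum (distance_matrix R e) lam) :
  (equidistant_number e
     <= #|[set i : 'I_#|T| | (tnth lam i <= -1)%R]| + 1)%N.
Proof.
apply/bigmax_leqP_seq => t; rewrite mem_index_iota => /andP[t_gt0 _] _.
apply/bigmax_leqP => S /forallP eqS.
pose toC := real_complex R.
pose A := map_mx toC (distance_matrix R e).
pose mu := [seq toC x | x <- lam].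
pose S' := [set enum_rank x | x in S].
have Aij i j : A i j = ((gdist e (enum_val i) (enum_val j))%:R)%R.
  by rewrite !mxE /toC rmorph_nat.
have Aherm : A \is hermsymmx.
  apply: realsym_hermsym.
    rewrite is_hermitianmxE expr0 scale1r; apply/eqP/matrixP => i j.
    by rewrite [RHS]mxE [X in _ = idfun X]mxE !Aij gdist_sym.
  by apply/mxOverP => i j; rewrite Aij realn.
have Amu : (char_poly A = \prod_(x <- mu) ('X - x%:P))%R.
  rewrite -map_char_poly lam_spec.1 rmorph_prod big_map big_tuple /=.
  by apply: eq_bigr => i _; rewrite rmorphB /= map_polyX map_polyC.
have t1 : (1 <= t%:R :> R[i])%R by rewrite ler1n.
rewrite -(card_imset S enum_rank_inj).
have -> : #|[set i : 'I_#|T| | (tnth lam i <= -1)%R]| =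
    count (fun x => (x <= -1)%R) mu.
  rewrite count_map -[X in count _ X]map_tnth_enum count_map -sum1_count -sum1_card.
  rewrite big_enum_cond.
  (* The embedding of [R] into [R[i]] preserves and reflects the order. *)
  by apply: eq_bigl => i; rewrite inE /= /toC -lecR rmorphN1.
apply: leq_card_equidistant_count Aherm Amu t1 _ => i j.
case/imsetP=> u uS -> /imsetP[v vS ->]; rewrite Aij !enum_rankK.
rewrite (inj_eq enum_rank_inj); case: eqVneq => [->|uv]; first by rewrite gdistxx.
have := eqS u; rewrite uS => /forallP/(_ v); rewrite vS uv.
by move/eqP => ->.
Qed.
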